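(* Let $\phi:H\to G$ be a virtual endomorphism of a group $G$ (a homomorphism from a subgroup $H<G$ of finite index). Let $(G,X^* )$ and $(G,Y^* )$ be contracting self-similar actions defined respectively by the triples $(\phi,T,C)$ and $(\phi,T',C')$, where $T=\{g_x\}_{x\in X}$, $T'=\{g'_y\}_{y\in Y}$ are left coset transversals of $H$ in $G$ and $C=\{h_x\}_{x\in X}$, $C'=\{h'_y\}_{y\in Y}$ are families of elements of $G$. Let $\alpha:\mathcal{X}_{(G,X^* )}\to\mathcal{X}_{(G,Y^* )}$ be the $G$-equivariant homeomorphism of limit $G$-spaces satisfying $\alpha(\tau_x(t))=\tau_y(\alpha(t))\cdot s_x$ for all $t\in\mathcal{X}_{(G,X^* )}$, $x\in X$, where $y\in Y$ is the letter with ${g'_y}^{-1}g_x\in H$ and $s_x={h'_y}^{-1}\phi({g'_y}^{-1}g_x)h_x$, and let $\bar\alpha:\mathscr{J}_{(G,X^* )}\to\mathscr{J}_{(G,Y^* )}$ be the induced homeomorphism of limit spaces. Then $\bar\alpha$ preserves the self-similar measures, i.e. $\mathsf{m}_{(G,Y^* )}(\bar\alpha(A))=\mathsf{m}_{(G,X^* )}(A)$ for any Borel set $A\subseteq\mathscr{J}_{(G,X^* )}$. In other words, the measure space $(\mathscr{J}_G,\mathsf{m})$ depends only on the associated virtual endomorphism $\phi$.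
   Context: Let $X$ be a finite nonempty set, $X^*$ the set of finite words over $X$, and $X^{-\omega}$ the space of left-infinite sequences $\ldots x_2x_1$, $x_i\in X$, with the product topology. A faithful (left) action of a group $G$ on $X^*$ is self-similar if for every $g\in G$, $x\in X$ there exist $h\in G$, $y\in X$ such that $g(xw)=y\,h(w)$ for all $w\in X^*$; then $h$ is denoted $g|_x$, and $g|_{x_1\ldots x_n}=g|_{x_1}|_{x_2}\cdots|_{x_n}$. The action is contracting if there is a finite set $\mathcal{N}\subset G$ such that for every $g\in G$ there is $k$ with $g|_v\in\mathcal{N}$ for all words $v$ of length $\ge k$. The action defined by $(\phi,T,C)$, where $\phi:H\to G$ with $[G:H]=|X|$, $T=\{g_x\}_{x\in X}$ is a left coset transversal for $H$ and $C=\{h_x\}_{x\in X}\subset G$, is given by $g(x)=x'$ and $g|_x=h_{x'}^{-1}\phi(g_{x'}^{-1}gg_x)h_x$, where $x'\in X$ is the unique letter with $g_{x'}^{-1}gg_x\in H$. Two elements $\ldots x_2x_1\cdot g$ and $\ldots y_2y_1\cdot h$ of $X^{-\omega}\times G$ ($G$ discrete) are asymptotically equivalent if there are a finite set $K\subset G$ and $g_n\in K$, $n\ge1$, with $g_n(x_n\ldots x_1)=y_n\ldots y_1$ and $g_n|_{x_n\ldots x_1}\cdot g=h$ for all $n\ge 1$. The limit $G$-space $\mathcal{X}_{(G,X^* )}$ is the quotient topological space of $X^{-\omega}\times G$ by this relation; $G$ acts on it from the right by multiplication on the $G$-coordinate. For $x\in X$ the map $\tau_x(\ldots x_2x_1\cdot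 g)=\ldots x_2x_1g(x)\cdot g|_x$ is a well-defined continuous self-map of $\mathcal{X}_{(G,X^* )}$. The limit space is $\mathscr{J}_{(G,X^* )}=\mathcal{X}_{(G,X^* )}/G$. The self-similar measure $\mathsf{m}_{(G,X^* )}$ on it is the push-forward of the uniform Bernoulli measure on $X^{-\omega}$ (each letter has weight $1/|X|$) under the surjection $X^{-\omega}\to\mathscr{J}_{(G,X^* )}$ sending $w$ to the $G$-orbit of the class of $w\cdot 1$. The same definitions are used for $Y$. A homeomorphism $\alpha$ as in the claim is known to exist. *)

(* Defs.v *)
From HB Require Import structures.
From mathcomp Require Import all_boot all_order all_algebra.
From mathcomp Require Import all_classical all_reals all_analysis.

Set Implicit Arguments.
Unset Strict Implicit.
Unset Printing Implicit Defensive.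

Import Order.TTheory GRing.Theory Num.Theory.
Import numFieldNormedType.Exports.

Local Open Scope classical_set_scope.
Local Open Scope quotient_scope.
Local Open Scope group_scope.

(* A finite nonempty alphabet. The distinguished point carries no content: it
   records nonemptiness in the form the measurable types of the library ask for. *)
#[short(type="pointedFinType")]
HB.structure Definition PointedFinite := {T of Finite T & Pointed T}.

Definition homeomorphism (S T : topologicalType) (f : S -> T) : Prop :=
  continuous f /\ exists g : T -> S, [/\ cancel f g, cancel g f & continuous g].

Notation borel T := (g_sigma_algebraType (@open T)).

Section VirtualEndomorphism.
Variable G : groupType.

Definition finite_index (H : {pred G}) : Prop :=
  exists s : seq G, forall g, exists2 t, t \in s & t^-1 * g \in H.

(* A homomorphism vdom -> G is encoded as a function on all of G; its values
   outside vdom are irrelevant. *)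
Record virtual_endomorphism := VirtualEndomorphism {
  vdom : groupClosed G;
  vdom_finite_index : finite_index vdom;
  vfun :> G -> G;
  vfunM : {in vdom &, {morph vfun : g h / g * h}} }.

Definition left_transversal (H : {pred G}) (I : Type) (t : I -> G) : Prop :=
  forall g, exists! i, (t i)^-1 * g \in H.

End VirtualEndomorphism.

Section SelfSimilarAction.
Variables (G : groupType) (X : finType).

(* X^* is [seq X], the head of the list being the leftmost letter. *)
Record selfsim_action := SelfSimAction {
  act :> G -> seq X -> seq X;
  act1 : forall w, act 1 w = w;
  actM : forall g h w, act (g * h) w = act g (act h w);
  act_faithful : forall g, (forall w, act g w = w) -> g = 1;
  act_selfsim : forall g x, exists h y,
    forall w, act g (x :: w) = y :: act h w }.

Variable a : selfsim_action.

Definition section (g : G) (x : X) : G := sval (cid (act_selfsim a g x)).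

Definition letter (g : G) (x : X) : X :=
  sval (cid (svalP (cid (act_selfsim a g x)))).

Definition section_word (g : G) (v : seq X) : G := foldl section g v.

Definition contracting : Prop :=
  exists2 N : set G, finite_set N &
    forall g, exists k, forall v, (k <= size v)%N -> N (section_word g v).

(* When [t] is a left transversal of [vdom phi], exactly one x' satisfies the
   membership condition, so this prescribes the image and the section. *)
Definition defined_by (phi : virtual_endomorphism G) (t c : X -> G) : Prop :=
  forall g x x', (t x')^-1 * g * t x \in vdom phi ->
    letter g x = x' /\
    section g x = (c x')^-1 * phi ((t x')^-1 * g * t x) * c x.

Lemma act_cons g x w : a g (x :: w) = letter g x :: a (section g x) w.
Proof.
rewrite /letter /section.
by case: (cid (act_selfsim a g x)) => h /= ?; case: cid => y /= ->.
Qed.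

Lemma act_inj g h : (forall w, a g w = a h w) -> g = h.
Proof.
move=> gh; suff : g * h^-1 = 1 by move=> /(congr1 (fun k => k * h)); rewrite mulgVK mul1g.
by apply: (act_faithful (s := a)) => w; rewrite actM gh -actM mulgV act1.
Qed.

Lemma section_unique g x h y :
  (forall w, a g (x :: w) = y :: a h w) -> letter g x = y /\ section g x = h.
Proof.
move=> gxw; split; first by have := gxw [::]; rewrite act_cons => -[].
by apply: act_inj => w; have := gxw w; rewrite act_cons => -[].
Qed.

Lemma letter1 x : letter 1 x = x.
Proof. by case: (@section_unique 1 x 1 x) => // w; rewrite !act1. Qed.

Lemma section1 x : section 1 x = 1.
Proof. by case: (@section_unique 1 x 1 x) => // w; rewrite !act1. Qed.

Lemma letterM g h x : letter (g * h) x = letter g (letter h x).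
Proof.
by case: (@section_unique (g * h) x (section g (letter h x) * section h x)
  (letter g (letter h x))) => // w; rewrite !actM !act_cons.
Qed.

Lemma sectionM g h x : section (g * h) x = section g (letter h x) * section h x.
Proof.
by case: (@section_unique (g * h) x (section g (letter h x) * section h x)
  (letter g (letter h x))) => // w; rewrite !actM !act_cons.
Qed.

Lemma section_word1 v : section_word 1 v = 1.
Proof. by elim: v => //= x v; rewrite /section_word /= section1. Qed.

Lemma act_nil g : a g [::] = [::].
Proof.
case E : (a g [::]) => [//|x w].
have := congr1 (a g^-1) E; rewrite -actM mulVg act1 act_cons //.
Qed.

Lemma section_wordM g h v :
  section_word (g * h) v = section_word g (a h v) * section_word h v.
Proof.
rewrite /section_word; elim: v g h => [|x v IH] g h; first by rewrite act_nil.
by rewrite act_cons /= sectionM IH.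
Qed.

Lemma act_rcons g v x :
  a g (rcons v x) = rcons (a g v) (letter (section_word g v) x).
Proof.
rewrite /section_word; elim: v g => [|y v IH] g /=.
  by rewrite act_cons !act_nil.
by rewrite !act_cons IH.
Qed.

Lemma section_word_rcons g v x :
  section_word g (rcons v x) = section (section_word g v) x.
Proof. by rewrite /section_word -cats1 foldl_cat. Qed.

End SelfSimilarAction.

(* X^{-omega}: the sequence ... x_2 x_1 is stored from the right, the letter
   x_{n+1} being [w n]. *)
Definition lseq (X : pointedFinType) : Type :=
  prod_topology (fun _ : nat => discrete_topology X).

HB.instance Definition _ (X : pointedFinType) := Topological.on (lseq X).
HB.instance Definition _ (X : pointedFinType) :=
  isPointed.Build (lseq X) (fun _ => point).

(* the word x_n ... x_1 *)
Definition lword (X : pointedFinType) (w : lseq X) (n : nat) : seq X :=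
  rev (mkseq w n).

Definition lcons (X : pointedFinType) (w : lseq X) (x : X) : lseq X :=
  fun n => if n is m.+1 then w m else x.

Lemma lword_lcons (X : pointedFinType) (w : lseq X) x n :
  lword (lcons w x) n.+1 = rcons (lword w n) x.
Proof.
rewrite /lword /mkseq /= rev_cons; congr (rcons (rev _) _).
by rewrite (iotaDl 1 0) -map_comp.
Qed.

Section Bernoulli.
Local Open Scope ring_scope.
Variables (R : realType) (X : pointedFinType).

Definition cylinder (v : seq X) : set (lseq X) :=
  [set w | lword w (size v) = v].

Lemma lwordS (w : lseq X) n : lword w n.+1 = w n :: lword w n.
Proof. by rewrite /lword mkseqS rev_rcons. Qed.

Lemma size_lword (w : lseq X) n : size (lword w n) = n.
Proof. by rewrite size_rev size_mkseq. Qed.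

Lemma lword_eqP (w u : lseq X) n :
  lword w n = lword u n <-> forall i, (i < n)%N -> w i = u i.
Proof.
elim: n => [|n IH]; first by split.
rewrite !lwordS; split=> [[wn /IH wu] i|wu].
  by rewrite ltnS leq_eqVlt => /orP[/eqP->|/wu].
congr (_ :: _); first exact: wu.
by apply/IH => i ilt; apply: wu; exact: ltnW.
Qed.

Lemma open_lseq_cylinder (U : set (lseq X)) w :
  open U -> U w -> exists n, cylinder (lword w n) `<=` U.
Proof.
move=> oU Uw; apply: contrapT => /forallNP noU.
have /choice[v vP] n : exists v : lseq X, lword v n = lword w n /\ ~ U v.
  have /existsNP[v /not_implyP[]] := noU n.
  by rewrite /cylinder /= size_lword => ? ?; exists v.
have vw : v @ \oo --> w.
  apply/cvg_sup => i A [_ /= [[B oB <-]]] /= Bw /filterS; apply.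
  exists i.+1 => // n /= ilt.
  by have [/lword_eqP/(_ i ilt) vn _] := vP n; rewrite /= vn.
have [|N _ /(_ N (leqnn N))] := vw U; first exact: open_nbhs_nbhs.
by have [] := vP N.
Qed.

Let k := #|X|.

Let k_gt0 : (0 < k)%N. Proof. by apply/card_gt0P; exists point. Qed.

Let pos n (t : R) : nat := Num.truncn (k%:R ^+ n * t).

(* the base-#|X| digits of [t], the letters being numbered by [enum_rank] *)
Let digits (t : R) : lseq X :=
  fun n => enum_val (Ordinal (ltn_pmod (pos n.+1 t) k_gt0)).

Let code (w : lseq X) : nat -> nat :=
  fix code n := if n is m.+1 then (code m * k + enum_rank (w m))%N else 0%N.

Let digits_code (t : R) w n : 0 <= t ->
  (t < 1 /\ lword (digits t) n = lword w n) <-> pos n t = code w n.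
Proof.
move=> t0; elim: n => [|n IH].
  rewrite /pos expr0 mul1r /=; split=> [[t1 _]|/eqP].
    by apply/eqP; rewrite truncn_eq// t0.
  by rewrite truncn_eq// => /andP[].
have kR : (0 < k%:R :> R) by rewrite ltr0n.
have posS : (pos n.+1 t %/ k)%N = pos n t.
  rewrite /pos exprS -mulrA; set s := _ * t.
  have s0 : 0 <= s by rewrite mulr_ge0// exprn_ge0// ler0n.
  symmetry; apply: truncn_def.
  have /andP[le1 le2] := truncn_itv (mulr_ge0 (ltW kR) s0).
  apply/andP; split.
    rewrite -(ler_pM2l kR); apply: le_trans le1.
    by rewrite -natrM ler_nat mulnC leq_divM.
  rewrite -(ltr_pM2l kR); apply: (lt_le_trans le2).
  by rewrite -natrM ler_nat mulnC ltn_ceil.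
rewrite !lwordS /=; split=> [[t1 [dn /= dl]]|pE].
  rewrite (divn_eq (pos n.+1 t) k) posS; congr (_ * _ + _)%N.
    by apply/IH.
  by rewrite -dn enum_valK.
have rlt : (enum_rank (w n) < k)%N by [].
have [|t1 ->] := IH.2.
  by rewrite -posS pE divnMDl// divn_small// addn0.
split=> //; congr (_ :: _); apply: enum_rank_inj; rewrite enum_valK.
by apply: val_inj => /=; rewrite pE modnMDl modn_small.
Qed.

Let lebesgue01 : {measure set (measurableTypeR R) -> \bar R} :=
  mrestr lebesgue_measure (measurable_itv `[0%R, 1%R[).

Let measurable_pos n m : measurable [set t : measurableTypeR R | pos n t = m].
Proof.
have mge p : measurable [set t : measurableTypeR R | (p <= pos n t)%N].
  case: p => [|p]; first by rewrite (_ : [set _ | _] = setT)//; apply/seteqP.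
  have kn : 0 < k%:R ^+ n :> R by rewrite exprn_gt0// ltr0n.
  rewrite (_ : [set _ | _] = `[p.+1%:R / k%:R ^+ n, +oo[%classic) //.
  apply/seteqP; split => t /=; rewrite in_itv /= andbT /pos truncn_gt_nat;
  by rewrite ler_pdivrMr// mulrC.
rewrite (_ : [set _ | _] = [set t | (m <= pos n t)%N] `\` [set t | (m.+1 <= pos n t)%N]).
  exact: measurableD.
apply/seteqP; split => t /=; first by move=> ->; rewrite leqnn ltnn.
case=> ? /negP; rewrite -leqNgt => ?.
by apply/eqP; rewrite eqn_leq; apply/andP.
Qed.

Let measurable_digit n x : measurable [set t : measurableTypeR R | digits t n = x].
Proof.
rewrite (_ : [set _ | _] =
    \bigcup_m [set t | pos n.+1 t = (m * k + enum_rank x)%N]).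
  by apply: bigcupT_measurable => m; exact: measurable_pos.
apply/seteqP; split => t /=.
  move=> <-; exists (pos n.+1 t %/ k)%N => //=.
  by rewrite enum_valK /= -divn_eq.
case=> m _ /= pE; apply: enum_rank_inj; rewrite enum_valK.
by apply: val_inj => /=; rewrite pE modnMDl modn_small.
Qed.

Let measurable_digits_cylinder w n :
  measurable [set t : measurableTypeR R | lword (digits t) n = lword w n].
Proof.
elim: n => [|n IH]; first by rewrite (_ : [set _ | _] = setT)//; apply/seteqP.
rewrite (_ : [set _ | _] = [set t | digits t n = w n] `&`
   [set t | lword (digits t) n = lword w n]); first exact: measurableI.
by apply/seteqP; split => t /=; rewrite !lwordS => -[-> ->].
Qed.

Let measurable_digits :
  measurable_fun [set: measurableTypeR R] (digits : _ -> borel (lseq X)).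
Proof.
apply: (@measurability _ _ (measurableTypeR R) (borel (lseq X)) _ _ (@open (lseq X))) => // _ [U oU <-]; rewrite setTI.
rewrite (_ : _ @^-1` _ = \bigcup_(s : seq X)
    [set t : measurableTypeR R | cylinder s `<=` U /\ cylinder s (digits t)]).
  apply: countable_bigcupT_measurable => [|s]; first exact: countableP.
  have [[]|sU] := pselect (cylinder s `<=` U /\ exists t, cylinder s (digits t)).
    move=> sU [t0 t0s].
    rewrite (_ : [set _ | _] =
      [set t | lword (digits t) (size s) = lword (digits t0) (size s)]) //.
    by apply/seteqP; rewrite t0s; split=> t //= -[].
  rewrite (_ : [set _ | _] = set0)//; apply/seteqP; split=> t //= -[? ?].
  by apply: sU; split=> //; exists t.
apply/seteqP; split=> t /=.
  move=> /(open_lseq_cylinder oU)[n nU]; exists (lword (digits t) n) => //.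
  by split=> //; rewrite /cylinder /= size_lword.
by case=> s _ /= [sU]; exact: sU.
Qed.

Lemma uniform_bernoulli_exists :
  exists mu : {measure set (borel (lseq X)) -> \bar R},
    forall v, mu (cylinder v) = ((#|X|%:R^-1) ^+ size v)%:E.
Proof.
(* the measure structure on [pushforward _ _] takes the measurability proof *)
pose mu : {measure set (borel (lseq X)) -> \bar R} :=
  pushforward lebesgue01 (digits : _ -> borel (lseq X)).
exists (mu measurable_digits) => v; set n := size v.
pose w : lseq X := fun i => nth point v (n - i.+1).
have vE : v = lword w n.
  apply: (@eq_from_nth _ point); first by rewrite size_lword.
  move=> i ilt; rewrite /lword nth_rev ?size_mkseq// nth_mkseq ?ltn_subrL ?(leq_trans _ ilt)//.
  by rewrite /w subnSK// subKn// ltnW.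
have kn : 0 < k%:R ^+ n :> R by rewrite exprn_gt0// ltr0n.
rewrite /mu /= /pushforward /lebesgue01 /= /mrestr.
rewrite (_ : _ `&` _ = `[(code w n)%:R / k%:R ^+ n, (code w n).+1%:R / k%:R ^+ n[%classic).
  rewrite lebesgue_measure_itv /= lte_fin ltr_pM2r ?invr_gt0// ltr_nat ltnSn.
  by rewrite -EFinB -mulrBl -natrB// subSnn mul1r exprVn.
apply/seteqP; split => t /=; rewrite !in_itv /= /cylinder /=.
  move=> [dv /andP[t0 t1]].
  have /(digits_code w n t0) pE : t < 1 /\ lword (digits t) n = lword w n.
    by split=> //; rewrite -vE.
  rewrite ler_pdivrMr// ltr_pdivlMr// mulrC -truncn_eq; first exact/eqP.
  by rewrite mulr_ge0// ltW.
rewrite ler_pdivrMr// ltr_pdivlMr// => ct.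
have t0 : 0 <= t.
  have /andP[+ _] := ct; move/(le_trans (ler0n _ _)); by rewrite pmulr_lge0.
have [] := (digits_code w n t0).2.
  apply/eqP; rewrite /pos truncn_eq; first by rewrite mulrC.
  by rewrite mulr_ge0// ltW.
by move=> t1; rewrite -vE t0 t1.
Qed.

(* Cylinders form a pi-system generating the Borel sets, so the chosen measure
   is the only one with these values. *)
Definition uniform_bernoulli : {measure set (borel (lseq X)) -> \bar R} :=
  sval (cid uniform_bernoulli_exists).

Lemma uniform_bernoulliE v :
  uniform_bernoulli (cylinder v) = ((#|X|%:R^-1) ^+ size v)%:E.
Proof. exact: svalP (cid uniform_bernoulli_exists) v. Qed.

End Bernoulli.

Section LimitSpaces.
Variables (G : groupType) (X : pointedFinType) (a : selfsim_action G X).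

Notation pre := (lseq X * discrete_topology G)%type.

Definition asymp_equiv (p q : pre) : Prop :=
  exists2 K : set G, finite_set K & exists g : nat -> G, forall n, (0 < n)%N ->
    [/\ K (g n), a (g n) (lword p.1 n) = lword q.1 n
      & section_word a (g n) (lword p.1 n) * (p.2 : G) = q.2].

Lemma asymp_equiv_refl p : asymp_equiv p p.
Proof.
exists [set 1]; first exact: finite_set1.
by exists (fun=> 1) => n _; rewrite act1 section_word1 mul1g.
Qed.

Lemma asymp_equiv_sym p q : asymp_equiv p q -> asymp_equiv q p.
Proof.
move=> [K fK [g gP]]; exists ((fun k : G => k^-1) @` K); first exact: finite_image.
exists (fun n => (g n)^-1) => n n0; have [Kg gw gs] := gP n n0.
split; first by exists (g n).
  by rewrite -gw -actM mulVg act1.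
have := section_wordM a (g n)^-1 (g n) (lword p.1 n).
rewrite mulVg section_word1 gw -gs mulgA => <-.
by rewrite mul1g.
Qed.

Lemma asymp_equiv_trans p q r :
  asymp_equiv p q -> asymp_equiv q r -> asymp_equiv p r.
Proof.
move=> [K fK [g gP]] [L fL [h hP]].
exists ((fun kl => kl.2 * kl.1) @` (K `*` L)).
  exact/finite_image/finite_setX.
exists (fun n => h n * g n) => n n0.
have [Kg gw gs] := gP n n0; have [Lh hw hs] := hP n n0.
split; first by exists (g n, h n).
  by rewrite actM gw hw.
by rewrite section_wordM gw -mulgA gs hs.
Qed.

Definition asymp_equivb : rel pre := fun p q => `[< asymp_equiv p q >].

Lemma asymp_equivb_refl : reflexive asymp_equivb.
Proof. by move=> p; apply/asboolP/asymp_equiv_refl. Qed.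

Lemma asymp_equivb_sym : symmetric asymp_equivb.
Proof. by move=> p q; apply/asboolP/asboolP; exact: asymp_equiv_sym. Qed.

Lemma asymp_equivb_trans : transitive asymp_equivb.
Proof.
by move=> q p r /asboolP pq /asboolP qr; apply/asboolP/(asymp_equiv_trans pq qr).
Qed.

Definition asymp_equiv_rel : equiv_rel pre :=
  EquivRel asymp_equivb asymp_equivb_refl asymp_equivb_sym asymp_equivb_trans.

Definition limitG : Type := quotient_topology {eq_quot asymp_equiv_rel}.
HB.instance Definition _ := Topological.on limitG.
HB.instance Definition _ := Quotient.on limitG.

Definition limitG_class (w : lseq X) (g : G) : limitG := \pi_limitG (w, g : discrete_topology G).

Lemma limitG_classP w g v h :
  limitG_class w g = limitG_class v h <-> asymp_equiv (w, g) (v, h).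
Proof.
rewrite /limitG_class; split=> [/eqmodP/asboolP //|?].
by apply/eqmodP/asboolP.
Qed.

Lemma limitG_repr t : limitG_class (repr t).1 (repr t).2 = t.
Proof. by rewrite /limitG_class -surjective_pairing reprK. Qed.

(* The maps on the quotients are defined through representatives; that the
   choice is immaterial is [limitG_actE], [tauE] and [induced_limit_mapE]. *)
Definition limitG_act (t : limitG) (k : G) : limitG :=
  limitG_class (repr t).1 ((repr t).2 * k).

Definition tau (x : X) (t : limitG) : limitG :=
  limitG_class (lcons (repr t).1 (letter a (repr t).2 x)) (section a (repr t).2 x).

Lemma limitG_actE w g k :
  limitG_act (limitG_class w g) k = limitG_class w (g * k).
Proof.
apply/limitG_classP.
have /limitG_classP[K fK [h hP]] := limitG_repr (limitG_class w g).
exists K => //; exists h => n /hP[? hw hs]; split=> //=.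
by rewrite mulgA; congr (_ * _).
Qed.

Lemma tauE x w g :
  tau x (limitG_class w g) = limitG_class (lcons w (letter a g x)) (section a g x).
Proof.
apply/limitG_classP.
have /limitG_classP := limitG_repr (limitG_class w g).
case: (repr _) => v h [K fK [f fP]] /=.
exists (K `|` [set g * h^-1]).
  by rewrite finite_setU; split=> //; exact: finite_set1.
exists (fun n => if n is m.+2 then f m.+1 else g * h^-1) => -[//|[|m]] _.
  split; first by right.
    by rewrite !lword_lcons /lword /= act_cons act_nil -letterM mulgVK.
  rewrite lword_lcons /lword /= /section_word /= -[X in _ = X](congr1 (section a ^~ x) (mulgVK h g)).
  by rewrite [RHS]sectionM.
have [Kf fw fs] := fP m.+1 isT; move: fw fs => /= fw fs.
split; first by left.
  by rewrite ![lword _ m.+2]lword_lcons act_rcons fw -letterM fs.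
by rewrite lword_lcons section_word_rcons -sectionM fs.
Qed.

Lemma limitG_act1 t : limitG_act t 1 = t.
Proof. by rewrite -[t]limitG_repr limitG_actE mulg1. Qed.

Lemma limitG_actM t g h : limitG_act (limitG_act t g) h = limitG_act t (g * h).
Proof. by rewrite -[t]limitG_repr !limitG_actE mulgA. Qed.

Definition orbit_equivb : rel limitG :=
  fun s t => `[< exists k, t = limitG_act s k >].

Lemma orbit_equivb_refl : reflexive orbit_equivb.
Proof. by move=> t; apply/asboolP; exists 1; rewrite limitG_act1. Qed.

Lemma orbit_equivb_sym : symmetric orbit_equivb.
Proof.
by move=> s t; apply/asboolP/asboolP => -[k ->]; exists k^-1;
  rewrite limitG_actM mulgV limitG_act1.
Qed.

Lemma orbit_equivb_trans : transitive orbit_equivb.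
Proof.
move=> t s r /asboolP[k ->] /asboolP[l ->]; apply/asboolP.
by exists (k * l); rewrite limitG_actM.
Qed.

Definition orbit_equiv_rel : equiv_rel limitG :=
  EquivRel orbit_equivb orbit_equivb_refl orbit_equivb_sym orbit_equivb_trans.

Definition limit_space : Type := quotient_topology {eq_quot orbit_equiv_rel}.
HB.instance Definition _ := Topological.on limit_space.
HB.instance Definition _ := Quotient.on limit_space.

Definition limit_class (t : limitG) : limit_space := \pi_limit_space t.

HB.instance Definition _ :=
  isPointed.Build limit_space (limit_class (limitG_class point 1)).

Lemma limit_classP s t :
  limit_class s = limit_class t <-> exists k, t = limitG_act s k.
Proof.
rewrite /limit_class; split=> [/eqmodP/asboolP //|?].
by apply/eqmodP/asboolP.
Qed.

Definition limit_proj (w : lseq X) : limit_space := limit_class (limitG_class w 1).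

End LimitSpaces.

Definition selfsim_measure (R : realType) (G : groupType) (X : pointedFinType)
    (a : selfsim_action G X) : set (borel (limit_space a)) -> \bar R :=
  pushforward (uniform_bernoulli R X : set (borel (lseq X)) -> \bar R)
    (limit_proj a : borel (lseq X) -> borel (limit_space a)).
Arguments selfsim_measure R {G X} a A : rename.

Section InducedMap.
Variables (G : groupType) (X Y : pointedFinType).
Variables (a : selfsim_action G X) (b : selfsim_action G Y).

Definition equivariant (f : limitG a -> limitG b) : Prop :=
  forall t k, f (limitG_act t k) = limitG_act (f t) k.

Definition induced_limit_map (f : limitG a -> limitG b)
  (j : limit_space a) : limit_space b := limit_class (f (repr j)).

Lemma induced_limit_mapE f t : equivariant f ->
  induced_limit_map f (limit_class t) = limit_class (f t).
Proof.
move=> feq; apply/limit_classP.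
have /limit_classP[k tE] :
  limit_class (repr (limit_class t)) = limit_class t by rewrite /limit_class reprK.
by exists k; rewrite -feq -tE.
Qed.

End InducedMap.

Section InducedHomeomorphism.
Variables (G : groupType) (X Y : pointedFinType).
Variables (a : selfsim_action G X) (b : selfsim_action G Y).
Variable f : limitG a -> limitG b.
Hypotheses (fhomeo : homeomorphism f) (feq : equivariant f).

Lemma induced_limit_map_homeomorphism : homeomorphism (induced_limit_map f).
Proof.
have [fc [g [fK gK gc]]] := fhomeo.
have geq : equivariant g by move=> t k; apply: (can_inj fK); rewrite feq !gK.
split; last exists (induced_limit_map g).
  apply/quotient_continuous => t.
  rewrite (_ : _ \o _ = limit_class (a := b) \o f); last first.
    by apply/funext => s /=; rewrite -induced_limit_mapE.
  by apply: continuous_comp; [exact: fc|exact: pi_continuous].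
split.
- move=> j; rewrite -[j]reprK -/(limit_class (repr j)).
  by rewrite !induced_limit_mapE// fK.
- move=> j; rewrite -[j]reprK -/(limit_class (repr j)).
  by rewrite !induced_limit_mapE// gK.
apply/quotient_continuous => t.
rewrite (_ : _ \o _ = limit_class (a := a) \o g); last first.
  by apply/funext => s /=; rewrite -induced_limit_mapE.
by apply: continuous_comp; [exact: gc|exact: pi_continuous].
Qed.

Lemma measurable_induced_limit_map (A : set (borel (limit_space a))) :
  measurable A ->
  measurable (induced_limit_map f @` A : set (borel (limit_space b))).
Proof.
have [_ [g [fK gK gc]]] := induced_limit_map_homeomorphism.
have mg : measurable_fun setT (g : borel (limit_space b) -> borel (limit_space a)).
  apply: (@measurability _ _ (borel (limit_space b)) (borel (limit_space a))
    _ _ (@open (limit_space a))) => // _ [U oU <-]; rewrite setTI.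
  by apply: sub_sigma_algebra; move/continuousP : gc; exact.
move=> mA; rewrite (_ : _ @` _ = setT `&` g @^-1` A); first exact: mg.
rewrite setTI; apply/seteqP; split=> [_ [j Aj <-] /=|j /= Agj].
  by rewrite fK.
by exists (g j).
Qed.

End InducedHomeomorphism.

(* Main.v *)
(* The transfer operator [transfer f w = |X|^-1 * sum_x f (w x)] preserves the
   Bernoulli integral, and alpha_tau says that the induced map of limit spaces
   intertwines the two transfer operators, matching the letters of X with those
   of Y. If C is a set of sequences determined by their last n letters and
   contained in the preimage of an open set U of the limit space over Y, the
   n-th iterate of the transfer operator turns the indicator of C into the
   constant with value the measure of C, hence the pull-back of U to the
   sequences over X has at least that measure. Exhausting the preimage of U by
   such sets gives one inequality between the two measures of U, and the inverse
   homeomorphism gives the other; open sets form a generating pi-system. *)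
Require Import Defs.
From mathcomp Require Import all_boot all_order all_algebra.
From mathcomp Require Import all_classical all_reals all_analysis.
From mathcomp Require Import measurable_realfun.

Set Implicit Arguments.
Unset Strict Implicit.
Unset Printing Implicit Defensive.

Import Order.TTheory GRing.Theory Num.Theory.

Local Open Scope classical_set_scope.
Local Open Scope group_scope.

Lemma measurable_fun_borel (S T : ptopologicalType) (f : S -> T) :
  continuous f -> measurable_fun setT (f : borel S -> borel T).
Proof.
move=> /continuousP cf.
apply: (@measurability _ _ (borel S) (borel T) _ _ (@open T)) => // _ [U oU <-].
by rewrite setTI; apply: sub_sigma_algebra; exact: cf.
Qed.

(** * Topology of left-infinite sequences *)

Section LeftInfiniteSequences.
Variable X : pointedFinType.
Implicit Types (w u : lseq X) (x : X).

Lemma near_lword w n : \forall u \near w, lword u n = lword w n.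
Proof.
elim: n => [|n IH]; first by near=> u.
have wn : \forall u \near w, u n = w n.
  have /(_ w [set w n]) := @proj_continuous _ (fun=> discrete_topology X) n.
  by apply; exact: discrete_set1.
by near=> u; rewrite !lwordS; congr (_ :: _); near: u.
Unshelve. all: by end_near. Qed.

Lemma open_lword_invariant (A : set (lseq X)) n :
  (forall w u, lword u n = lword w n -> A w -> A u) -> open A.
Proof.
move=> An; rewrite openE => w Aw; rewrite /interior.
by near=> u; apply: An Aw; near: u; exact: near_lword.
Unshelve. all: by end_near. Qed.

Lemma lword_lconsE w u x n :
  lword u n = lword w n -> lword (lcons u x) n.+1 = lword (lcons w x) n.+1.
Proof. by rewrite !lword_lcons => ->. Qed.

Lemma lword_leq w u m n : (m <= n)%N -> lword u n = lword w n ->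
  lword u m = lword w m.
Proof.
move=> mn /lword_eqP uw; apply/lword_eqP => i im.
by apply: uw; exact: leq_trans mn.
Qed.

Lemma lcons_continuous x : continuous (fun w => lcons w x).
Proof.
apply/continuousP => U oU; rewrite openE => w /= Uwx; rewrite /interior.
have [n nU] := open_lseq_cylinder oU Uwx.
near=> u; apply: nU; rewrite /cylinder /= size_lword.
apply: (lword_leq (leqnSn n)); apply: lword_lconsE.
by near: u; exact: near_lword.
Unshelve. all: by end_near. Qed.

End LeftInfiniteSequences.

(** * The transfer operator and invariance of the Bernoulli integral *)

Section TransferOperator.
Local Open Scope ring_scope.
Local Open Scope ereal_scope.
Variables (R : realType) (X : pointedFinType).
Let beta : {measure set (borel (lseq X)) -> \bar R} := uniform_bernoulli R X.
Implicit Types f : lseq X -> \bar R.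

Let card_gt0 : (0 < #|X|)%N. Proof. by apply/card_gt0P; exists point. Qed.

(** This is the Ruelle operator, with uniform weights, of the shift that deletes the rightmost
    letter. *)
Definition transfer f (w : lseq X) : \bar R :=
  (#|X|%:R^-1)%:E * \sum_(x : X) f (lcons w x).

Lemma open_cylinder (v : seq X) : open (cylinder v).
Proof.
apply: (@open_lword_invariant _ _ (size v)) => w u.
by rewrite /cylinder /= => ->.
Qed.

(** Cylinders that meet are nested, so the longer word decides. Together with the empty set,
    cylinders thus form a pi-system. *)
Lemma cylinder_setI (v v' : seq X) w : (cylinder v `&` cylinder v') w ->
  cylinder v `&` cylinder v' = cylinder (lword w (maxn (size v) (size v'))).
Proof.
move=> [/= wv wv']; apply/seteqP; rewrite /cylinder; split=> u /=; rewrite size_lword.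
  move=> [uv uv']; rewrite /maxn; case: ifP => _; first by rewrite uv' wv'.
  by rewrite uv wv.
move=> uw; split; [rewrite -[RHS]wv|rewrite -[RHS]wv'].
  exact: lword_leq (leq_maxl _ _) uw.
exact: lword_leq (leq_maxr _ _) uw.
Qed.

(** Only the last letter of a nonempty word contributes; its preimage is the cylinder of the word
    without that letter, of mass [#|X|] times larger. For the empty word all [#|X|] preimages have
    mass 1. *)
Lemma bernoulli_lcons_cylinder (v : seq X) :
  (#|X|%:R^-1)%:E * \sum_(x : X) beta ((fun w => lcons w x) @^-1` cylinder v) =
  beta (cylinder v).
Proof.
have Xn0 : (#|X|%:R : R) != 0%R by rewrite pnatr_eq0 -lt0n.
case/lastP: v => [|v y].
  have c0 : cylinder [::] = [set: lseq X] by apply/seteqP.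
  have b1 : beta [set: lseq X] = 1 by rewrite -c0 /beta uniform_bernoulliE expr0.
  rewrite c0 b1 (eq_bigr (fun=> 1%R%:E))//.
  by rewrite sumEFin sumr_const -EFinM mulVf.
rewrite (bigD1 y) //= big1 ?adde0 => [|x xy].
  rewrite (_ : _ @^-1` _ = cylinder v).
    by rewrite !uniform_bernoulliE -EFinM size_rcons exprS.
  apply/seteqP; split=> w; rewrite /cylinder /= size_rcons lword_lcons.
    by move/rcons_inj => -[].
  by move=> ->.
rewrite (_ : _ @^-1` _ = set0) ?measure0//.
apply/seteqP; split=> w //; rewrite /cylinder /= size_rcons lword_lcons.
by move/rcons_inj => -[_ /eqP]; rewrite (negbTE xy).
Qed.

Lemma cylinder_measure_unique (m1 m2 : {measure set (borel (lseq X)) -> \bar R}) :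
  m1 setT < +oo -> (forall v, m1 (cylinder v) = m2 (cylinder v)) ->
  forall A, measurable A -> m1 A = m2 A.
Proof.
move=> m1T m12 A mA.
pose Cyl : set (set (lseq X)) := [set B | B = set0 \/ exists v, B = cylinder v].
have openCyl : @open (lseq X) `<=` <<s Cyl >>.
  move=> U oU.
  (* Words are countable, so [U] is a countable union of cylinders; a word whose cylinder is not
     inside [U] contributes the empty set. *)
  rewrite (_ : U = \bigcup_(v : seq X) [set w | cylinder v `<=` U /\ cylinder v w]).
    apply: (@countable_bigcupT_measurable _ (g_sigma_algebraType Cyl)).
      exact: countableP.
    move=> v; have [vU|vU] := pselect (cylinder v `<=` U).
      apply: sub_sigma_algebra; right; exists v.
      by apply/seteqP; split=> [w []|w].
    rewrite (_ : [set _ | _] = set0); first exact: measurable0.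
    by apply/seteqP; split=> w // -[].
  apply/seteqP; split=> [w Uw|w [v _ [vU /vU]]//].
  have [n nU] := open_lseq_cylinder oU Uw.
  by exists (lword w n) => //; split=> //; rewrite /cylinder /= size_lword.
apply: (@g_sigma_algebra_measure_unique _ R (borel (lseq X)) Cyl _
  (fun=> cylinder [::]) _ _ m1 m2) => //.
- move=> _ [->|[v ->]]; first exact: measurable0.
  by apply: sub_sigma_algebra; exact: open_cylinder.
- by move=> _; right; exists [::].
- by apply/seteqP; split=> // w _; exists 0%N.
- move=> B C [->|[v ->]]; first by rewrite set0I; left.
  move=> [->|[v' ->]]; first by rewrite setI0; left.
  have [->|/set0P[w vv']] := eqVneq (cylinder v `&` cylinder v') set0; first by left.
  by right; rewrite (cylinder_setI vv'); eexists.
- by move=> B [->|[v ->]]; rewrite ?measure0.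
- by move=> _; rewrite (_ : cylinder [::] = setT)//; apply/seteqP.
- apply: smallest_sub mA; last exact: openCyl.
  exact: smallest_sigma_algebra.
Qed.

Lemma uniform_bernoulli_setT : beta setT = 1.
Proof.
have <- : cylinder [::] = [set: lseq X] by apply/seteqP.
by rewrite /beta uniform_bernoulliE expr0.
Qed.

Lemma transfer_ge0 f : (forall w, 0 <= f w) -> forall w, 0 <= transfer f w.
Proof.
move=> f0 w; apply: mule_ge0; first by rewrite lee_fin invr_ge0.
exact: sume_ge0.
Qed.

Lemma measurable_lcons x : measurable_fun setT
  ((fun w => lcons w x) : borel (lseq X) -> borel (lseq X)).
Proof. exact: (measurable_fun_borel (@lcons_continuous _ _)). Qed.

Lemma measurable_transfer f :
  measurable_fun [set: borel (lseq X)] f ->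
  measurable_fun [set: borel (lseq X)] (transfer f).
Proof.
move=> mf; apply: measurable_funeM; apply: emeasurable_sum => x.
exact: (measurableT_comp mf (measurable_lcons x)).
Qed.

(** Integrating [transfer f] amounts to integrating [f] against the mean of the push-forwards of
    [beta] under appending a letter. That mean agrees with [beta] on cylinders, hence everywhere. *)
Lemma integral_transfer f :
  measurable_fun [set: borel (lseq X)] f -> (forall w, 0 <= f w) ->
  \int[beta]_w transfer f w = \int[beta]_w f w.
Proof.
move=> mf f0.
have k0 : (0 <= #|X|%:R^-1 :> R)%R by rewrite invr_ge0.
(* [msum] is indexed by naturals, hence the numbering of letters by [enum X]. Only indices below
   [#|X|] enter the sum, so the default [point] of [nth] never does. *)
pose l i : borel (lseq X) -> borel (lseq X) := fun w => lcons w (nth point (enum X) i).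
have ml i : measurable_fun setT (l i) by exact: measurable_lcons.
have sumE (F : X -> \bar R) :
    \sum_(x : X) F x = \sum_(i < #|X|) F (nth point (enum X) i).
  by rewrite -[LHS]big_enum (big_nth point) /= big_mkord -cardE.
pose m_ i : {measure set (borel (lseq X)) -> \bar R} := pushforward beta (l i).
pose mean : {measure set (borel (lseq X)) -> \bar R} :=
  mscale (NngNum k0) (msum (m_ ml) #|X|).
transitivity (\int[mean]_w f w).
  rewrite ge0_integral_mscale// ge0_integral_measure_sum// /transfer.
  rewrite ge0_integralZl_EFin//; last 2 first.
    by move=> w _; exact: sume_ge0.
    by apply: emeasurable_sum => x; exact: (measurableT_comp mf (measurable_lcons x)).
  congr (_ * _); rewrite ge0_integral_sum//; last first.
    by move=> x; exact: (measurableT_comp mf (measurable_lcons x)).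
  by rewrite sumE; apply: eq_bigr => i _; rewrite [RHS]ge0_integral_pushforward.
apply: eq_measure_integral => A mA _.
have meanE v : mean (cylinder v) = beta (cylinder v).
  by rewrite -bernoulli_lcons_cylinder sumE.
apply: cylinder_measure_unique mA => //.
have c0 : cylinder [::] = [set: lseq X] by apply/seteqP.
rewrite -[X in X < _]/(mean [set: lseq X]) -c0 meanE /beta.
by rewrite uniform_bernoulliE ltry.
Qed.

Lemma iter_transfer_ge0 f n :
  (forall w, 0 <= f w) -> forall w, 0 <= iter n transfer f w.
Proof. by move=> f0; elim: n => //= n; exact: transfer_ge0. Qed.

Lemma measurable_iter_transfer f n : measurable_fun [set: borel (lseq X)] f ->
  measurable_fun [set: borel (lseq X)] (iter n transfer f).
Proof. by move=> mf; elim: n => //= n; exact: measurable_transfer. Qed.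

Lemma integral_iter_transfer f n : measurable_fun [set: borel (lseq X)] f ->
  (forall w, 0 <= f w) ->
  \int[beta]_w iter n transfer f w = \int[beta]_w f w.
Proof.
move=> mf f0; elim: n => //= n <-; apply: integral_transfer.
  exact: measurable_iter_transfer.
exact: iter_transfer_ge0.
Qed.

(** Each application shortens the dependence by one letter: if [f] sees the last n+1 letters,
    [transfer f] sees only the last n. *)
Lemma iter_transfer_cst f n :
  (forall w u, lword u n = lword w n -> f u = f w) ->
  forall w u, iter n transfer f u = iter n transfer f w.
Proof.
elim: n f => [|n IH] f fn w u; first exact: fn.
rewrite !iterSr; apply: IH => {}w {}u wu.
rewrite /transfer; congr (_ * _); apply: eq_bigr => x _.
by apply: fn; exact: lword_lconsE.
Qed.

End TransferOperator.

(** * Comparison of Bernoulli measures along a correspondence of sequences *)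

Section CompareBernoulli.
Local Open Scope ring_scope.
Local Open Scope ereal_scope.
Variables (R : realType) (X Y : pointedFinType) (rel : lseq X -> lseq Y -> Prop).
(** [rel] models two sequences having corresponding images in the limit spaces. It is a relation
    because projections to these spaces need not be injective; the bijection of letters may vary
    with [w] and [u]. *)
Hypothesis rel_left_total : forall w, exists u, rel w u.
Hypothesis rel_lcons : forall w u, rel w u ->
  exists2 s : X -> Y, bijective s & forall x, rel (lcons w x) (lcons u (s x)).
Let betaX : {measure set (borel (lseq X)) -> \bar R} := uniform_bernoulli R X.
Let betaY : {measure set (borel (lseq Y)) -> \bar R} := uniform_bernoulli R Y.

(** The bijection of letters reindexes the sum and forces [X] and [Y] to have equal cardinality, so
    the normalizing factors agree. *)
Lemma transfer_le (f : lseq X -> \bar R) (f' : lseq Y -> \bar R) :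
  (forall w u, rel w u -> f' u <= f w) ->
  forall w u, rel w u -> transfer f' u <= transfer f w.
Proof.
move=> ff' w u /rel_lcons[s bs rs].
rewrite /transfer (bij_eq_card bs) lee_wpmul2l ?lee_fin ?invr_ge0//.
rewrite (reindex s)/=; last exact: onW_bij.
by apply: lee_sum => x _; exact: ff' (rs x).
Qed.

Lemma iter_transfer_le (f : lseq X -> \bar R) (f' : lseq Y -> \bar R) n :
  (forall w u, rel w u -> f' u <= f w) ->
  forall w u, rel w u -> iter n (@transfer R Y) f' u <= iter n (@transfer R X) f w.
Proof. by move=> ff'; elim: n => //= n IH; exact: transfer_le. Qed.

Lemma bernoulli_le_of_lword_invariant (C : set (lseq Y)) (E : set (borel (lseq X))) n :
  (forall u u', lword u' n = lword u n -> C u -> C u') -> measurable E ->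
  (forall w u, rel w u -> C u -> E w) -> betaY C <= betaX E.
Proof.
move=> Cn mE CE.
have mC : measurable (C : set (borel (lseq Y))).
  by apply: sub_sigma_algebra; exact: open_lword_invariant Cn.
pose c : \bar R := iter n (@transfer R Y) (EFin \o \1_C) point.
have cE u : iter n (@transfer R Y) (EFin \o \1_C) u = c.
  apply: iter_transfer_cst => {}u u' uu' /=; congr (_%:E); rewrite !indicE.
  by congr (_%:R); congr nat_of_bool; apply/idP/idP; rewrite !inE; exact: Cn.
have mIC : measurable_fun [set: borel (lseq Y)] (EFin \o \1_C : lseq Y -> \bar R).
  exact/measurable_EFinP/measurable_indic.
have mIE : measurable_fun [set: borel (lseq X)] (EFin \o \1_E : lseq X -> \bar R).
  exact/measurable_EFinP/measurable_indic.
have -> : betaY C = c.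
  rewrite -[C in LHS]setIT -integral_indic// -(integral_iter_transfer n)//.
  under eq_integral do rewrite cE.
  by rewrite integral_cst// uniform_bernoulli_setT mule1.
rewrite -[E]setIT -integral_indic// -(integral_iter_transfer n)//.
(* Since [betaX] has mass 1, [c] is also an integral over sequences in [X]; a pointwise bound by the
   iterate for [E] then suffices. *)
rewrite -[c]mule1 -(uniform_bernoulli_setT R X) -integral_cst//.
apply: ge0_le_integral => //.
- by move=> w _; rewrite /= -(cE point) iter_transfer_ge0// => u; rewrite lee_fin.
- exact: measurable_iter_transfer.
(* Any [u] related to [w] will do, because the iterate for [C] takes the value [c] everywhere. *)
move=> w _; have [u wu] := rel_left_total w.
rewrite /= -(cE u); apply: iter_transfer_le wu => {}w {}u wu /=.
rewrite lee_fin !indicE ler_nat; case: (boolP (u \in C)) => // /set_mem uC.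
by rewrite mem_set//; exact: CE uC.
Qed.

(** An open [V] is the increasing union of its largest subsets [C n] determined by the last n
    letters; continuity from below carries the bound from each [C n] to [V]. *)
Lemma bernoulli_le (V : set (lseq Y)) (E : set (borel (lseq X))) :
  open V -> measurable E -> (forall w u, rel w u -> V u -> E w) ->
  betaY V <= betaX E.
Proof.
move=> oV mE VE; pose C n : set (lseq Y) := [set u | cylinder (lword u n) `<=` V].
have Cn n u u' : lword u' n = lword u n -> C n u -> C n u' by rewrite /C /= => ->.
have CV n : C n `<=` V by move=> u; apply; rewrite /cylinder /= size_lword.
have VC : V = \bigcup_n C n.
  apply/seteqP; split=> [u /(open_lseq_cylinder oV)[n nV]|u [n _ /CV]//].
  by exists n.
have mC n : measurable (C n : set (borel (lseq Y))).
  by apply: sub_sigma_algebra; exact: open_lword_invariant (Cn n).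
have cvC : betaY \o C @ \oo --> betaY V.
  rewrite [in betaY V]VC; apply: (nondecreasing_cvg_mu (T := borel (lseq Y))) => //.
    exact: bigcupT_measurable.
  move=> m n mn; apply/subsetPset => u mu v.
  rewrite /cylinder /= size_lword => vu; apply: mu.
  by rewrite /cylinder /= size_lword; exact: lword_leq vu.
rewrite -(cvg_lim _ cvC)//; apply: lime_le; first by apply/cvg_ex; exists (betaY V).
apply: nearW => n; apply: bernoulli_le_of_lword_invariant (Cn n) mE _.
by move=> w u wu /CV; exact: VE.
Qed.

End CompareBernoulli.

(** * The limit spaces and the equality of their measures *)

Lemma pair_cst_continuous (S T : topologicalType) (c : T) :
  continuous (fun x : S => (x, c)).
Proof. by move=> x; apply: cvg_pair; [exact: cvg_id|exact: cvg_cst]. Qed.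

Section LimitProjection.
Variables (G : groupType) (X : pointedFinType) (a : selfsim_action G X).

Lemma limit_proj_continuous : continuous (limit_proj a).
Proof.
pose one : discrete_topology G := (1 : G).
have pair1 : continuous (fun w : lseq X => (w, one)).
  exact: pair_cst_continuous.
have class1 : continuous (fun w : lseq X => limitG_class a w 1).
  by move=> w; apply: (continuous_comp (pair1 w)); exact: pi_continuous.
by move=> w; apply: (continuous_comp (class1 w)); exact: pi_continuous.
Qed.

Lemma limit_proj_surj (j : limit_space a) : exists w, limit_proj a w = j.
Proof.
exists (repr (repr j)).1; rewrite -[RHS]reprK -[in RHS](limitG_repr (repr j)).
by apply/limit_classP; exists (repr (repr j)).2; rewrite limitG_actE mul1g.
Qed.

Lemma limit_class_act (t : limitG a) k : limit_class (limitG_act t k) = limit_class t.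
Proof. by symmetry; apply/limit_classP; exists k. Qed.

Lemma limit_class_proj w k : limit_class (limitG_class a w k) = limit_proj a w.
Proof. by rewrite -[k]mul1g -limitG_actE limit_class_act. Qed.

Lemma letter_bij k : bijective (letter a k).
Proof.
by exists (letter a k^-1) => x; rewrite -letterM ?mulVg ?mulgV letter1.
Qed.

End LimitProjection.

(** Both families index the left cosets of [H], so letters are matched when they name the same
    coset; closure of [H] under inverses makes the two matchings mutually inverse. *)
Lemma transversal_matching (G : groupType) (H : groupClosed G) (X Y : finType)
    (g : X -> G) (g' : Y -> G) :
  left_transversal H g -> left_transversal H g' ->
  exists2 s : X -> Y, bijective s & forall x, (g' (s x))^-1 * g x \in H.
Proof.
move=> gT g'T.
have /choice[s sP] x : exists y, (g' y)^-1 * g x \in H.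
  by have [y [? _]] := g'T (g x); exists y.
have /choice[r rP] y : exists x, (g x)^-1 * g' y \in H.
  by have [x [? _]] := gT (g' y); exists x.
exists s => //; exists r => [x|y].
  have [x0 [_ uniq]] := gT (g' (s x)).
  rewrite -(uniq _ (rP _)); apply: uniq.
  by rewrite -gpredV invgM invgK.
have [y0 [_ uniq]] := g'T (g (r y)).
rewrite -(uniq _ (sP _)); apply: uniq.
by rewrite -gpredV invgM invgK.
Qed.

Theorem corollary19 (R : realType) (G : groupType)
  (phi : virtual_endomorphism G)
  (X Y : pointedFinType)
  (g h : X -> G) (g' h' : Y -> G)
  (gT : left_transversal (vdom phi) g) (g'T : left_transversal (vdom phi) g')
  (a : selfsim_action G X) (b : selfsim_action G Y)
  (a_def : defined_by a phi g h) (b_def : defined_by b phi g' h')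
  (a_contr : contracting a) (b_contr : contracting b)
  (alpha : limitG a -> limitG b)
  (alpha_homeo : homeomorphism alpha)
  (alpha_equiv : equivariant alpha)
  (alpha_tau : forall (t : limitG a) (x : X) (y : Y),
    (g' y)^-1 * g x \in vdom phi ->
    alpha (tau x t) =
      limitG_act (tau y (alpha t)) ((h' y)^-1 * phi ((g' y)^-1 * g x) * h x)) :
  forall A : set (borel (limit_space a)), measurable A ->
    selfsim_measure R b (induced_limit_map alpha @` A) = selfsim_measure R a A.
Proof.
pose rel w u := induced_limit_map alpha (limit_proj a w) = limit_proj b u.
have rel_lcons w u : rel w u ->
    exists2 s : X -> Y, bijective s & forall x, rel (lcons w x) (lcons u (s x)).
  rewrite /rel induced_limit_mapE// => /esym/limit_classP[k alphaE].
  have [s bs sP] := transversal_matching gT g'T.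
  (* Here [alpha] sends the class of [w] and 1 to that of [u] and [k], and [tau y] appends
     [letter b k y] to [u]. The right factor in [alpha_tau] disappears in the orbit space. *)
  exists (letter b k \o s) => [|x]; first exact: bij_comp (letter_bij b k) bs.
  rewrite induced_limit_mapE//.
  have -> : limitG_class a (lcons w x) 1 = tau x (limitG_class a w 1).
    by rewrite tauE letter1 section1.
  rewrite (alpha_tau _ _ _ (sP x)) limit_class_act alphaE limitG_actE mul1g tauE.
  exact: limit_class_proj.
have rel_lcons' u w : rel w u ->
    exists2 s : Y -> X, bijective s & forall y, rel (lcons w (s y)) (lcons u y).
  move=> /rel_lcons[s [r sK rK] sP]; exists r => [|y]; first by exists s.
  by rewrite -{2}[y]rK; exact: sP.
have [alphac [alphaV [alphaK alphaVK alphaVc]]] :=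
  induced_limit_map_homeomorphism alpha_homeo alpha_equiv.
have rel_total w : exists u, rel w u.
  have [u uP] := limit_proj_surj (induced_limit_map alpha (limit_proj a w)).
  by exists u.
have rel_total' u : exists w, rel w u.
  have [w wP] := limit_proj_surj (alphaV (limit_proj b u)).
  by exists w; rewrite /rel wP alphaVK.
move=> A mA.
(* Writing the image as a preimage under the inverse turns both sides into push-forward measures on
   the same space. *)
have -> : induced_limit_map alpha @` A = alphaV @^-1` A.
  apply/seteqP; split=> [_ [j Aj <-] /=|j /= Abj]; first by rewrite alphaK.
  by exists (alphaV j).
have pc := limit_proj_continuous (a := a).
have qc : continuous (alphaV \o limit_proj b).
  by move=> u; apply: continuous_comp; [exact: limit_proj_continuous|exact: alphaVc].
pose mX : {measure set (borel (limit_space a)) -> \bar R}%R :=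
  pushforward (uniform_bernoulli R X) (limit_proj a : borel _ -> borel _).
pose mY : {measure set (borel (limit_space a)) -> \bar R}%R :=
  pushforward (uniform_bernoulli R Y) (alphaV \o limit_proj b : borel _ -> borel _).
have mp := measurable_fun_borel pc; have mq := measurable_fun_borel qc.
suff : mY mq A = mX mp A by [].
apply: (@g_sigma_algebra_measure_unique _ R (borel (limit_space a))
  (@open (limit_space a)) _ (fun=> setT) _ _ (mY mq) (mX mp)) => //.
- exact: sub_sigma_algebra.
- by move=> _; exact: openT.
- by apply/seteqP; split=> // w _; exists 0%N.
- by move=> U V; exact: openI.
(* On an open set each inequality is one use of [bernoulli_le], the second with [X] and [Y]
   exchanged and [rel] reversed. *)
- move=> U oU; have oX : open (limit_proj a @^-1` U) by move/continuousP : pc; exact.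
  have oY : open ((alphaV \o limit_proj b) @^-1` U) by move/continuousP : qc; exact.
  apply/eqP; rewrite eq_le; apply/andP; split.
    apply: (@bernoulli_le R X Y rel rel_total rel_lcons _
      (limit_proj a @^-1` U) oY); first exact: sub_sigma_algebra.
    by move=> w u wu /=; rewrite -wu alphaK.
  apply: (@bernoulli_le R Y X (fun u w => rel w u) rel_total' rel_lcons' _
    ((alphaV \o limit_proj b) @^-1` U) oX); first exact: sub_sigma_algebra.
  by move=> u w wu /=; rewrite -wu alphaK.
- by move=> _; rewrite /mY /= /pushforward preimage_setT uniform_bernoulli_setT ltry.
Qed.
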